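(* Let $r>0$, $p_0>0>p_2$, and $\mathsf u(s)=-\frac1r\log\Big(\frac{s+\sqrt{s^2-4p_0p_2}}{2p_0}\Big)$ for $s\in\mathbb R$, with cost $\mathsf c(x,\bar x)=\mathsf u(x^{\mathsf T}\bar x)$ on $\mathbb R^n\times\mathbb R^n$. Let $\varphi$ be a strictly convex, continuous, absolutely-homogeneous function of order $\alpha>1$ on $\mathbb R^n$ (so $\varphi(tx)=|t|^\alpha\varphi(x)$), which is $C^1$ at $x\ne0$, and such that $x\mapsto\mathrm{grad}_\varphi(x)$ is invertible for $x\neq0$. Then for all $\bar x\in\mathbb R^n$, the function $L(\cdot,\bar x):\mathbb R^n\to\mathbb R$, $x\mapsto\mathsf u(x^{\mathsf T}\bar x)+\varphi(x)$, has a unique global minimum $x_{\mathrm{opt},\bar x}$. If $\bar x\ne0$, $x_{\mathrm{opt},\bar x}$ is the unique root $x$ of the equation $$\frac{2r(-p_0p_2)^{1/2}}{(1-\alpha^2r^2\varphi(x)^2)^{1/2}}\,\mathrm{grad}_\varphi(x)=\bar x,$$ and for $\bar x=0$, $x_{\mathrm{opt},\bar x}=0$. Thus $\psi(\bar x):=\varphi^{\bar{\mathsf c}}(\bar x)$ is defined for all $\bar x\in\mathbb R^n$ as $-L(x_{\mathrm{opt},\bar x},\bar x)$, with $\bar x^{\mathsf T}\mathrm{grad}_\psi(\bar x)<\frac1r$, and the following function $\phi$ is $\mathsf c$-convex: $$\phi(x):=\varphi^{\bar{\mathsf c}\mathsf c}(x)=\begin{cases}\varphi(x)&\text{if }\v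arphi(x)<\frac1{r\alpha},\\[2pt]\frac1{r\alpha}\big(1+\log(r\alpha\varphi(x))\big)&\text{otherwise.}\end{cases}$$
   Context: The transforms are $\varphi^{\bar{\mathsf c}}(\bar x)=\sup_{x}(-\mathsf c(x,\bar x)-\varphi(x))$ and $\psi^{\mathsf c}(x)=\sup_{\bar x}(-\mathsf c(x,\bar x)-\psi(\bar x))$, with $x,\bar x\in\mathbb R^n$; $\varphi^{\bar{\mathsf c}\mathsf c}=(\varphi^{\bar{\mathsf c}})^{\mathsf c}$. A function $\phi$ is $\mathsf c$-convex if $\phi=\psi^{\mathsf c}$ for some $\psi$ (equivalently $\phi^{\bar{\mathsf c}\mathsf c}=\phi$). The function $\mathsf u$ is the inverse of $\mathsf s(u)=p_0e^{-ru}+p_2e^{ru}$. Invertibility of $\mathrm{grad}_\varphi$ for $x\ne0$ means that $\mathrm{grad}_\varphi$ is a bijection of $\mathbb R^n\setminus\{0\}$ onto itself. In the displayed root equation, $x$ is required to satisfy $\varphi(x)<\frac1{r\alpha}$ so that the left-hand side is defined. *)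

(* Defs.v *)
From HB Require Import structures.
From mathcomp Require Import all_boot all_order all_algebra.
From mathcomp Require Import all_classical all_reals all_analysis.

Set Implicit Arguments.
Unset Strict Implicit.
Unset Printing Implicit Defensive.

Import Order.TTheory GRing.Theory Num.Theory.
Import numFieldNormedType.Exports.

Local Open Scope classical_set_scope.
Local Open Scope ring_scope.

(* Points of R^n are row vectors. *)
Definition dot (R : realType) (n : nat) (x y : 'rV[R]_n) : R :=
  (x *m y^T) 0 0.

Definition grad (R : realType) (n : nat) (f : 'rV[R]_n -> R) (x : 'rV[R]_n) :
  'rV[R]_n := \row_i 'D_(delta_mx 0 i) f x.

Definition strictly_convex (R : realType) (n : nat) (f : 'rV[R]_n -> R) : Prop :=
  forall (x y : 'rV[R]_n) (t : R), x != y -> 0 < t < 1 ->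
    f (t *: x + (1 - t) *: y) < t * f x + (1 - t) * f y.

Definition abs_homogeneous (R : realType) (n : nat) (alpha : R)
  (f : 'rV[R]_n -> R) : Prop :=
  forall (t : R) (x : 'rV[R]_n), f (t *: x) = `|t| `^ alpha * f x.

Definition C1_off0 (R : realType) (n : nat) (f : 'rV[R]_n -> R) : Prop :=
  forall x : 'rV[R]_n, x != 0 ->
    differentiable f x /\ {for x, continuous (grad f)}.

(* The transforms act on extended-real-valued functions, so that the suprema
   always exist; the cost is finite, so no difference is of the form oo - oo. *)
Definition cbar_transform (R : realType) (X Y : Type) (c : X -> Y -> R)
  (phi : X -> \bar R) (y : Y) : \bar R :=
  ereal_sup (range (fun x => - (c x y)%:E - phi x)%E).

Definition c_transform (R : realType) (X Y : Type) (c : X -> Y -> R)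
  (psi : Y -> \bar R) (x : X) : \bar R :=
  ereal_sup (range (fun y => - (c x y)%:E - psi y)%E).

Definition c_convex (R : realType) (X Y : Type) (c : X -> Y -> R)
  (phi : X -> \bar R) : Prop :=
  exists psi : Y -> \bar R, phi = c_transform c psi.

(* The inverse of s(u) = p0 e^(-ru) + p2 e^(ru), for r > 0 and p0 > 0 > p2. *)
Definition ufun (R : realType) (r p0 p2 : R) (s : R) : R :=
  - r^-1 * ln ((s + Num.sqrt (s ^+ 2 - 4 * p0 * p2)) / (2 * p0)).

Definition cost (R : realType) (n : nat) (r p0 p2 : R) (x xb : 'rV[R]_n) : R :=
  ufun r p0 p2 (dot x xb).

Definition objective (R : realType) (n : nat) (r p0 p2 : R) (phi : 'rV[R]_n -> R)
  (x xb : 'rV[R]_n) : R :=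
  ufun r p0 p2 (dot x xb) + phi x.

Definition global_min (R : realType) (X : Type) (f : X -> R) (x : X) : Prop :=
  forall y : X, f x <= f y.

(* The bound on phi x keeps the square root and the quotient away from their
   default values. *)
Definition is_root (R : realType) (n : nat) (r p0 p2 alpha : R)
  (phi : 'rV[R]_n -> R) (xb x : 'rV[R]_n) : Prop :=
  phi x < (r * alpha)^-1 /\
  (2 * r * Num.sqrt (- (p0 * p2)) /
    Num.sqrt (1 - alpha ^+ 2 * r ^+ 2 * phi x ^+ 2)) *: grad phi x = xb.

Definition phi_log (R : realType) (n : nat) (r alpha : R)
  (phi : 'rV[R]_n -> R) (x : 'rV[R]_n) : R :=
  if phi x < (r * alpha)^-1 then phi x
  else (r * alpha)^-1 * (1 + ln (r * alpha * phi x)).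

(* Main.v *)
(* Write s = dot x xb and q(s) = sqrt(s^2 - 4 p0 p2), so that u' = -1/(r q).
   Euler's identity x . grad phi(x) = alpha phi(x) shows that the root equation
   says exactly that grad phi(x) = xb / (r q(s)), i.e. that x is a critical point
   of the objective.  A critical point is the strict global minimum: on the half
   space where dot y xb >= 0 both u (convex on the nonnegative reals) and phi lie
   above their tangents at x, and on the other half space y is beaten by -y.
   Roots exist because grad phi is onto and homogeneous, which leaves a scalar
   equation.  The conjugate psi is differentiable because it is squeezed between
   increments of u along the minimizers at the two points, and the minimizers
   depend continuously on xb by compactness of {phi <= 1/(r alpha)}.  For the
   double transform, x with phi x < 1/(r alpha) is itself the minimizer for
   its dual point; otherwise the supremum is approached along the dual points
   of t x, as t x reaches the level set phi = 1/(r alpha) from inside. *)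
Require Import Defs.
From HB Require Import structures.
From mathcomp Require Import all_boot all_order all_algebra.
From mathcomp Require Import all_classical all_reals all_analysis.
From mathcomp Require Import ring lra.

Set Implicit Arguments.
Unset Strict Implicit.
Unset Printing Implicit Defensive.

Import Order.TTheory GRing.Theory Num.Theory.
Import numFieldNormedType.Exports.

Local Open Scope classical_set_scope.
Local Open Scope ring_scope.

(** * The scalar cost *)

Section ScalarCost.
Variables (R : realType) (r p0 p2 : R).
Hypotheses (r_gt0 : 0 < r) (p0_gt0 : 0 < p0) (p2_lt0 : p2 < 0).

Definition discr (s : R) : R := Num.sqrt (s ^+ 2 - 4 * p0 * p2).

Lemma discr_arg_gt0 s : 0 < s ^+ 2 - 4 * p0 * p2.
Proof.
have p02 : p0 * p2 < 0 by rewrite pmulr_rlt0.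
by have := sqr_ge0 s; lra.
Qed.

Lemma discr_gt0 s : 0 < discr s.
Proof. by rewrite sqrtr_gt0 discr_arg_gt0. Qed.

Lemma sqr_discr s : discr s ^+ 2 = s ^+ 2 - 4 * p0 * p2.
Proof. by rewrite sqr_sqrtr // ltW ?discr_arg_gt0. Qed.

(** Since [p0 * p2 < 0], the radicand exceeds [s ^+ 2]. This keeps the argument of the logarithm
    positive and later gives the bound [r^-1] on the gradient of the conjugate. *)
Lemma norm_lt_discr s : `|s| < discr s.
Proof.
rewrite -(@ltr_pXn2r _ 2) ?nnegrE //; last exact/ltW/discr_gt0.
have p02 : p0 * p2 < 0 by rewrite pmulr_rlt0.
by rewrite sqr_discr real_normK ?num_real //; lra.
Qed.

Lemma addr_discr_gt0 s : 0 < s + discr s.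
Proof. by have := norm_lt_discr s; rewrite ltr_norml => /andP[]; lra. Qed.

Lemma continuous_discr : continuous discr.
Proof.
move=> s; apply: continuous_comp; last exact: sqrt_continuous.
apply: cvgB; last exact: cvg_cst.
exact: exprn_continuous.
Qed.

(** Writing q for [discr], the chain rule gives (1 + s/q) / (s + q), which simplifies to 1/q. *)
Lemma is_derive_ufun (s : R) :
  is_derive s 1 (ufun r p0 p2) (- (r * discr s)^-1).
Proof.
have q0 := discr_gt0 s.
have sq0 := addr_discr_gt0 s.
have p00 : 0 < 2 * p0 by rewrite mulr_gt0.
have d1 : is_derive s 1 (fun s => s ^+ 2 - 4 * p0 * p2) (2 * s).
  apply: is_derive_eq; rewrite ?subr0 /= /GRing.scale /=; ring.
have d2 : is_derive s 1 discr ((2 * discr s)^-1 * (2 * s)).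
  exact: (@is_derive1_comp _ _ (fun s => s ^+ 2 - 4 * p0 * p2) _ _ _
    (is_derive1_sqrt (discr_arg_gt0 s)) d1).
have d3 : is_derive s 1 (fun s => (2 * p0)^-1 *: (s + discr s))
    ((2 * p0)^-1 *: (1 + (2 * discr s)^-1 * (2 * s))).
  exact: is_deriveZ.
have sp0 : 0 < (2 * p0)^-1 *: (s + discr s) by rewrite mulr_gt0 ?invr_gt0.
have d4 := @is_derive1_comp _ _ (fun s => (2 * p0)^-1 *: (s + discr s)) _ _ _
  (is_derive1_ln sp0) d3.
have -> : ufun r p0 p2 =
    (fun s => - r^-1 *: ((@ln R) \o (fun s => (2 * p0)^-1 *: (s + discr s))) s).
  by apply/funext => t /=; rewrite /ufun /discr /GRing.scale /= [_ / _]mulrC.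
apply: is_derive_eq; rewrite /GRing.scale /=; field.
by rewrite !gt_eqF.
Qed.

Lemma continuous_ufun : continuous (ufun r p0 p2).
Proof.
move=> s; apply/differentiable_continuous/derivable1_diffP.
by have [] := is_derive_ufun s.
Qed.

(** Stated with [Num.min] and [Num.max] so that it applies without knowing the order of [a] and
    [b]. *)
Lemma ufun_mvt (a b : R) : exists2 c, Num.min a b <= c <= Num.max a b &
  ufun r p0 p2 a - ufun r p0 p2 b = (r * discr c)^-1 * (b - a).
Proof.
wlog ab : a b / a <= b => [H|].
  have [/H//|/H[c cab E]] := orP (le_total a b).
  exists c; first by rewrite minC maxC.
  by rewrite -opprB E -mulrN opprB.
have [||c] := @MVT_segment _ (ufun r p0 p2) (fun s => - (r * discr s)^-1) a b ab.
- by move=> x _; exact: is_derive_ufun.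
- by apply: continuous_subspaceT; exact: continuous_ufun.
move=> + E; rewrite in_itv /= => cab; exists c.
  by rewrite min_l // max_r.
by rewrite -opprB E mulNr opprK.
Qed.

Lemma ufun_decr : {homo ufun r p0 p2 : a b /~ a < b}.
Proof.
move=> b a ab; have [c _ E] := ufun_mvt a b.
by rewrite -subr_gt0 E mulr_gt0 ?subr_gt0 // invr_gt0 mulr_gt0 ?discr_gt0.
Qed.

(** [discr] is smallest at 0, so the slope of u is steepest there. *)
Lemma ufun_lipschitz : exists2 K, 0 < K &
   forall a b, `|ufun r p0 p2 a - ufun r p0 p2 b| <= K * `|a - b|.
Proof.
exists ((r * discr 0)^-1); first by rewrite invr_gt0 mulr_gt0 ?discr_gt0.
move=> a b; have [c _ ->] := ufun_mvt a b.
have rc : 0 < r * discr c by rewrite mulr_gt0 ?discr_gt0.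
have rd : 0 < r * discr 0 by rewrite mulr_gt0 ?discr_gt0.
rewrite normrM distrC ger0_norm ?invr_ge0 ?(ltW rc) //.
apply: ler_wpM2r => //; rewrite lef_pV2 // ler_pM2l //; apply: ler_wsqrtr.
by have := sqr_ge0 c; lra.
Qed.

(** On the nonnegative reals [discr] increases, hence so does the derivative -1/(r q): u is convex
    there. *)
Lemma ufun_tangent (a b : R) : 0 <= a -> 0 <= b ->
  ufun r p0 p2 a - (r * discr a)^-1 * (b - a) <= ufun r p0 p2 b.
Proof.
move=> a0 b0; have [c] := ufun_mvt a b.
rewrite ge_min le_max => cab E.
have rc : 0 < r * discr c by rewrite mulr_gt0 ?discr_gt0.
have ra : 0 < r * discr a by rewrite mulr_gt0 ?discr_gt0.
have c0 : 0 <= c by case/andP: cab => /orP[] ? _; lra.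
have dm x y : 0 <= x -> 0 <= y -> x <= y -> (r * discr y)^-1 <= (r * discr x)^-1.
  move=> x0 y0 xy; rewrite lef_pV2 ?posrE ?mulr_gt0 ?discr_gt0 //.
  rewrite ler_pM2l //; apply: ler_wsqrtr.
  by rewrite lerB // ler_pXn2r.
suff : (r * discr c)^-1 * (b - a) <= (r * discr a)^-1 * (b - a) by lra.
have [ab|/ltW ba] := leP a b.
  rewrite ler_wpM2r ?subr_ge0 // dm //.
  by case/andP: cab => /orP[] ? _; lra.
rewrite ler_wnM2r ?subr_le0 // dm //.
by case/andP: cab => _ /orP[] ?; lra.
Qed.

(** For [s <= 0] the left side is nonpositive by monotonicity and the right side nonnegative. For
    [s > 0] the claim reduces to t q(s) <= q(t s), which after squaring follows from t^2 <= 1. *)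
Lemma ufun_scale_le (s t : R) : 0 < t <= 1 ->
  ufun r p0 p2 (t * s) - ufun r p0 p2 s <= - r^-1 * ln t.
Proof.
move=> /andP[t0 t1].
have lt0 : 0 <= - r^-1 * ln t.
  by rewrite mulr_le0 ?oppr_le0 ?invr_ge0 ?(ltW r_gt0) // ln_le0.
have [s0|s0] := leP s 0.
  apply: le_trans lt0; rewrite subr_le0.
  have : s <= t * s.
    have : 0 <= (1 - t) * - s by rewrite mulr_ge0 ?subr_ge0 ?oppr_ge0.
    lra.
  by rewrite le_eqVlt => /predU1P[<-//|/ufun_decr/ltW].
rewrite /ufun -mulrBr -/(discr s) -/(discr (t * s)).
have q1 := addr_discr_gt0 s; have q2 := addr_discr_gt0 (t * s).
have P : 0 < (2 * p0)^-1 by rewrite invr_gt0 mulr_gt0.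
rewrite -ln_div ?posrE ?mulr_gt0 //.
rewrite ler_wnM2l ?oppr_le0 ?invr_ge0 ?(ltW r_gt0) // ler_ln ?posrE ?divr_gt0 ?mulr_gt0 //.
rewrite ler_pdivlMr ?mulr_gt0 // mulrA ler_pM2r //.
rewrite mulrDr lerD2l.
rewrite -(@ler_pXn2r _ 2) ?nnegrE //; last 2 first.
- by rewrite mulr_ge0 // ltW ?discr_gt0.
- by rewrite ltW ?discr_gt0.
have p02 : p0 * p2 < 0 by rewrite pmulr_rlt0.
have t21 : t ^+ 2 <= 1 by rewrite expr_le1 // ltW.
have : 0 <= (1 - t ^+ 2) * - (p0 * p2) by rewrite mulr_ge0 ?subr_ge0 ?oppr_ge0 ?(ltW p02).
rewrite !exprMn !sqr_discr exprMn; lra.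
Qed.

(** Asymptotic converse of [ufun_scale_le]: the correction m/s vanishes as s grows. It comes from
    q(s) >= s and q(t s) <= t s + 2 m. *)
Lemma ufun_scale_ge (s t : R) : 0 < s -> 0 < t ->
  - r^-1 * ln (t + Num.sqrt (- (p0 * p2)) / s)
    <= ufun r p0 p2 (t * s) - ufun r p0 p2 s.
Proof.
move=> s0 t0; set m := Num.sqrt _.
have p02 : p0 * p2 < 0 by rewrite pmulr_rlt0.
have m0 : 0 < m by rewrite sqrtr_gt0 oppr_gt0.
have m2 : m ^+ 2 = - (p0 * p2) by rewrite sqr_sqrtr // oppr_ge0 ltW.
rewrite /ufun -mulrBr -/(discr s) -/(discr (t * s)).
have q1 := addr_discr_gt0 s; have q2 := addr_discr_gt0 (t * s).
have P : 0 < (2 * p0)^-1 by rewrite invr_gt0 mulr_gt0.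
rewrite -ln_div ?posrE ?mulr_gt0 //.
rewrite ler_wnM2l ?oppr_le0 ?invr_ge0 ?(ltW r_gt0) //.
have tms : 0 < t + m / s by rewrite addr_gt0 ?divr_gt0.
rewrite ler_ln ?posrE ?divr_gt0 ?mulr_gt0 //.
rewrite ler_pdivrMr ?mulr_gt0 // mulrA ler_pM2r //.
have ds : s <= discr s by rewrite (le_trans (ler_norm _)) // ltW ?norm_lt_discr.
have dt : discr (t * s) <= t * s + 2 * m.
  rewrite -(@ler_pXn2r _ 2) ?nnegrE //; last 2 first.
  - by rewrite ltW ?discr_gt0.
  - by rewrite ltW ?addr_gt0 ?mulr_gt0.
  have tsm : 0 < t * s * m by rewrite !mulr_gt0.
  rewrite sqr_discr sqrrD [(2 * m) ^+ 2]exprMn m2; lra.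
apply: (@le_trans _ _ ((t + m / s) * (s + s))); last first.
  by rewrite ler_pM2l // lerD2l.
have -> : (t + m / s) * (s + s) = t * s + (t * s + 2 * m).
  by field; rewrite gt_eqF.
by rewrite lerD2l.
Qed.

End ScalarCost.

(** * Homogeneous strictly convex functions *)

Section Dot.
Variables (R : realType) (n : nat).
Implicit Types x y v : 'rV[R]_n.

Lemma dotE x y : dot x y = \sum_i x 0 i * y 0 i.
Proof. by rewrite /dot mxE; apply: eq_bigr => i _; rewrite mxE. Qed.

Lemma dotC x y : dot x y = dot y x.
Proof. by rewrite !dotE; apply: eq_bigr => i _; rewrite mulrC. Qed.

Lemma dotZl (t : R) x y : dot (t *: x) y = t * dot x y.
Proof. by rewrite /dot -scalemxAl mxE. Qed.

Lemma dotZr (t : R) x y : dot x (t *: y) = t * dot x y.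
Proof. by rewrite dotC dotZl dotC. Qed.

Lemma dotDl x y v : dot (x + y) v = dot x v + dot y v.
Proof. by rewrite /dot mulmxDl mxE. Qed.

Lemma dotNl x y : dot (- x) y = - dot x y.
Proof. by rewrite -scaleN1r dotZl mulN1r. Qed.

Lemma dotDr x y v : dot x (y + v) = dot x y + dot x v.
Proof. by rewrite !(dotC x) dotDl. Qed.

Lemma dotNr x y : dot x (- y) = - dot x y.
Proof. by rewrite !(dotC x) dotNl. Qed.

Lemma dot0l x : dot 0 x = 0. Proof. by rewrite -(scale0r 0) dotZl mul0r. Qed.

Lemma dot0r x : dot x 0 = 0. Proof. by rewrite dotC dot0l. Qed.

Lemma dot_delta x i : dot x (delta_mx 0 i) = x 0 i.
Proof.
rewrite dotE (bigD1 i) //= big1 ?addr0 => [|j ji]; rewrite mxE eqxx /=.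
  by rewrite eqxx mulr1.
by rewrite (negPf ji) mulr0.
Qed.

Lemma coord_le_norm x i : `|x 0 i| <= `|x|.
Proof.
rewrite [leRHS]/Num.norm /= mx_normrE; apply/bigmax_geP; right => /=.
by exists (0, i).
Qed.

Lemma norm_dot_le x y : `|dot x y| <= n%:R * `|x| * `|y|.
Proof.
rewrite dotE (le_trans (ler_norm_sum _ _ _)) //.
apply: (@le_trans _ _ (\sum_(i < n) `|x| * `|y|)).
  by apply: ler_sum => i _; rewrite normrM ler_pM ?coord_le_norm.
by rewrite sumr_const card_ord -mulrA mulr_natl.
Qed.

Lemma cvg_dot (T : Type) (F : set_system T) (FF : Filter F)
  (f g : T -> 'rV[R]_n) (a b : 'rV[R]_n) :
  f @ F --> a -> g @ F --> b -> dot (f t) (g t) @[t --> F] --> dot a b.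
Proof.
move=> fa gb; rewrite dotE; under eq_cvg do rewrite dotE.
apply: cvg_big => [|i _]; first exact: add_continuous.
by apply: (@cvgM R T F FF);
  [apply: (cvg_comp f (fun x : 'rV[R]_n => x 0 i) fa)
  |apply: (cvg_comp g (fun x : 'rV[R]_n => x 0 i) gb)];
  exact: coord_continuous.
Qed.

Lemma derive_grad (f : 'rV[R]_n -> R) x v : differentiable f x ->
  'D_v f x = dot (grad f x) v.
Proof.
move=> df; rewrite deriveE // {1}(row_sum_delta v) linear_sum dotE.
by apply: eq_bigr => i _; rewrite linearZ /= -deriveE // mxE mulrC.
Qed.

End Dot.

(** * Absolutely homogeneous functions: positivity, Euler's identity, scaling of the gradient *)

Section Homogeneous.
Variables (R : realType) (n : nat) (alpha : R) (phi : 'rV[R]_n -> R).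
Hypothesis phi_homog : abs_homogeneous alpha phi.
Implicit Types x y v : 'rV[R]_n.

Lemma homog_even x : phi (- x) = phi x.
Proof. by rewrite -scaleN1r phi_homog normrN1 powR1 mul1r. Qed.

Lemma homog0 : alpha != 0 -> phi 0 = 0.
Proof.
by move=> a0; rewrite -(scale0r 0) phi_homog normr0 powR0 // mul0r.
Qed.

(** The midpoint of [x] and [- x] is 0, where [phi] vanishes, and [phi] takes the same value at both
    ends. *)
Lemma homog_pos x : alpha != 0 -> strictly_convex phi -> x != 0 -> 0 < phi x.
Proof.
move=> a0 cvx x0.
have xNx : x != - x.
  by rewrite eq_sym -subr_eq0 -opprD oppr_eq0 -mulr2n -scaler_nat scaler_eq0 pnatr_eq0.
have h : 0 < (2^-1 : R) < 1 by apply/andP; split; lra.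
have := cvx x (- x) 2^-1 xNx h.
have -> : 1 - 2^-1 = 2^-1 :> R by lra.
by rewrite scalerN subrr homog0 // homog_even; lra.
Qed.

(** Both sides are the derivative at t = 1 of phi(t x), which equals t^alpha phi(x) for t near 1. *)
Lemma homog_euler x : differentiable phi x -> dot (grad phi x) x = alpha * phi x.
Proof.
move=> dphi; rewrite -derive_grad //.
have D : is_derive (1 : R) 1 (phi x *: (@powR R ^~ alpha))
    (phi x *: (alpha * 1 `^ (alpha - 1))).
  by apply: is_deriveZ; exact: (is_derive1_powR alpha ltr01).
have -> : alpha * phi x = phi x *: (alpha * 1 `^ (alpha - 1)).
  by rewrite powR1 mulr1 /GRing.scale /= mulrC.
have [_ <-] := D.
have -> : 'D_x phi x = 'D_1 (fun t : R => phi (t *: x)) 1.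
  have E : (fun h : R => h^-1 *: ((phi \o shift x) (h *: x) - phi x)) =
      (fun h : R => h^-1 *: (((fun t : R => phi (t *: x)) \o shift 1) (h *: (1 : R))
        - phi (1 *: x))).
    apply/funext => h /=.
    by rewrite scale1r scalerDl scale1r [h *: (1 : R)]mulr1.
  by rewrite /derive E.
apply: near_eq_derive.
near=> t.
have t0 : 0 < t by near: t; exact: lt_nbhsr.
by rewrite phi_homog (gtr0_norm t0) mulrC.
Unshelve. all: by end_near. Qed.

(** The difference quotient of [phi] at [t *: x] along [t *: v] is t^alpha times the one at [x]
    along [v]; linearity of the differential takes one factor t out of the direction. *)
Lemma homog_grad (t : R) x : 0 < t -> differentiable phi x ->
  differentiable phi (t *: x) ->
  grad phi (t *: x) = t `^ (alpha - 1) *: grad phi x.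
Proof.
move=> t0 dx dtx; apply/rowP => i; rewrite !mxE.
set v := delta_mx 0 i.
apply: (@mulfI _ t); first by rewrite gt_eqF.
rewrite mulrA.
have -> : t * t `^ (alpha - 1) = t `^ alpha.
  by rewrite powRB ?(gt_eqF t0) ?implybT // powRr1 ?ltW // mulrC divfK ?gt_eqF.
have -> : t * 'D_v phi (t *: x) = 'D_(t *: v) phi (t *: x).
  by rewrite !deriveE // linearZ.
rewrite /derive; apply: cvg_lim => //.
have -> : (fun h => h^-1 *: ((phi \o shift (t *: x)) (h *: (t *: v)) - phi (t *: x)))
   = (fun h => t `^ alpha * (h^-1 *: ((phi \o shift x) (h *: v) - phi x))).
  apply/funext => h /=.
  rewrite scalerA [h * t]mulrC -scalerA -scalerDr !phi_homog gtr0_norm //.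
  by rewrite -mulrBr /GRing.scale /= mulrCA.
by apply: cvgMl_tmp; exact: (diff_derivable dx).
Qed.

(** The difference quotient at 0 along [v] has absolute value |h|^(alpha - 1) |phi(v)|, which tends
    to 0 because [alpha > 1]. *)
Lemma homog_grad0 : 1 < alpha -> grad phi 0 = 0.
Proof.
move=> a1; apply/rowP => i; rewrite !mxE; set v := delta_mx 0 i.
rewrite /derive; apply: cvg_lim => //.
apply/cvgr0Pnorm_lt => e e0.
have b0 : 0 < alpha - 1 by lra.
have c0 : 0 < `|phi v| + 1 by rewrite ltr_wpDl.
(* Chosen so that d^(alpha - 1) (|phi(v)| + 1) = e; the added 1 avoids dividing by zero. *)
pose d := (e / (`|phi v| + 1)) `^ (alpha - 1)^-1.
have d0 : 0 < d by rewrite powR_gt0 // divr_gt0.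
have ed : d `^ (alpha - 1) = e / (`|phi v| + 1).
  by rewrite -powRrM mulVf ?gt_eqF // powRr1 // ltW // divr_gt0.
near=> h.
have h0 : h != 0 by near: h; exact: nbhs_dnbhs_neq.
have hd : `|h| < d.
  near: h; apply: dnbhs0_lt => //.
rewrite /= addr0 phi_homog homog0 ?subr0; last by rewrite gt_eqF // (lt_trans ltr01).
have E : `|h| `^ alpha = `|h| * `|h| `^ (alpha - 1).
  by rewrite powRB ?normr_eq0 ?h0 ?implybT // powRr1 // mulrC divfK // normr_eq0.
rewrite E normrZ normfV !normrM normr_id [`|_ `^ _|]ger0_norm ?powR_ge0 //.
rewrite -mulrA mulKf ?normr_eq0 //.
apply: (@lt_le_trans _ _ (`|h| `^ (alpha - 1) * (`|phi v| + 1))).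
  by rewrite ltr_pM2l ?ltrDl // powR_gt0 // normr_gt0.
rewrite -ler_pdivlMr // -ed.
by apply: ge0_ler_powR; rewrite ?nnegrE ?(ltW d0) ?(ltW b0) ?(ltW hd) //.
Unshelve. all: by end_near. Qed.

End Homogeneous.

(** * Tangent inequalities for strictly convex functions *)

Section Convex.
Variables (R : realType) (n : nat) (f : 'rV[R]_n -> R).
Hypothesis f_cvx : strictly_convex f.
Implicit Types x y : 'rV[R]_n.

(** Convexity bounds the difference quotients along [y - x] by [f y - f x] for steps in (0, 1); the
    bound passes to the limit from the right. *)
Lemma convex_tangent_le x y : differentiable f x ->
  f x + dot (grad f x) (y - x) <= f y.
Proof.
move=> dfx; have [->|yx] := eqVneq y x; first by rewrite subrr dot0r addr0.
rewrite -lerBrDl -derive_grad //.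
have cv := cvg_dnbhs_at_right (diff_derivable (v := y - x) dfx).
apply: (cvgr_to_le cv); near=> h.
have h0 : 0 < h by near: h; exact: nbhs_right_gt.
have h1 : h < 1 by near: h; exact: nbhs_right_lt.
have h01 : 0 < h < 1 by rewrite h0.
have := f_cvx yx h01.
have -> : h *: y + (1 - h) *: x = h *: (y - x) + x.
  by rewrite scalerBr scalerBl scale1r addrA addrAC.
rewrite /= /GRing.scale /= ler_pdivrMl // => H.
by rewrite mulrBr; lra.
Unshelve. all: by end_near. Qed.

(** Strictness comes from the midpoint: the weak inequality holds there, and [f] at the midpoint is
    strictly below the average. *)
Lemma convex_tangent_lt x y : differentiable f x -> y != x ->
  f x + dot (grad f x) (y - x) < f y.
Proof.
move=> dfx yx.
have h01 : 0 < (2^-1 : R) < 1 by apply/andP; split; lra.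
have := f_cvx yx h01.
have := convex_tangent_le (2^-1 *: y + (1 - 2^-1) *: x) dfx.
have -> : 2^-1 *: y + (1 - 2^-1) *: x - x = 2^-1 *: (y - x).
  by rewrite scalerBl scale1r scalerBr addrA addrAC addrK.
rewrite dotZr; lra.
Qed.

End Convex.

(** * Auxiliary facts on limits, differentials, suprema and exponential equations *)

Lemma cvg_between (R : realType) (T : Type) (F : set_system T) (FF : Filter F)
  (a b c : T -> R) (l : R) :
  a @ F --> l -> b @ F --> l ->
  (forall t, Num.min (a t) (b t) <= c t <= Num.max (a t) (b t)) -> c @ F --> l.
Proof.
move=> al bl H; apply/cvgrPdist_lt => e e0; near=> t.
have : `|l - a t| < e by near: t; apply: cvgr_dist_lt.
have : `|l - b t| < e by near: t; apply: cvgr_dist_lt.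
have := H t; rewrite ge_min le_max !ltr_norml.
by move=> /andP[/orP[?|?] /orP[?|?]] /andP[? ?] /andP[? ?]; apply/andP; split; lra.
Unshelve. all: by end_near. Qed.

(** Lets [dot w] serve as a candidate differential. *)
HB.instance Definition _ (R : realType) (n : nat) (w : 'rV[R]_n) :=
  GRing.isLinear.Build R 'rV[R]_n R _ (@dot R n w)
    (fun a x y => etrans (dotDr w (a *: x) y) (congr1 (+%R^~ (dot w y)) (dotZr a w x))).

Lemma is_diff_eps (R : numFieldType) (V W : normedModType R) (f : V -> W)
    (df : {linear V -> W}) (x : V) :
  continuous df ->
  (forall e, 0 < e -> \forall y \near x,
     `|f y - f x - df (y - x)| <= e * `|y - x|) ->
  is_diff x f df.
Proof.
move=> cdf H.
have E : f \o shift x = cst (f x) + df +o_ 0 id.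
  apply/eqaddoP => e e0.
  have := H e e0; rewrite (near_shift 0 x) => H'; near=> h.
  have : `|f (h + x) - f x - df (h + x - x)| <= e * `|h + x - x|.
    by near: h; move: H'; apply: filterS => h /=; rewrite subr0.
  rewrite addrK -addrA -opprD; exact.
have D := diff_unique cdf E.
apply: DiffDef => //; apply/diff_locallyP; split.
  by rewrite D.
by rewrite D.
Unshelve. all: by end_near. Qed.

Lemma differentiable_grad_eps (R : realType) (n : nat) (f : 'rV[R]_n -> R) (x w : 'rV[R]_n) :
  (forall e, 0 < e -> \forall y \near x,
     `|f y - f x - dot w (y - x)| <= e * `|y - x|) ->
  differentiable f x /\ grad f x = w.
Proof.
move=> H.
have cw : continuous (dot w).
  move=> y; apply: (@cvg_dot R n _ (nbhs y) _ (fun=> w) id); last exact: cvg_id.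
  exact: cvg_cst.
have [df D] := is_diff_eps cw H.
split=> //; apply/rowP => i; rewrite mxE deriveE // D.
exact: dot_delta.
Qed.

(** The second hypothesis concerns real bounds only, so infinite suprema are treated apart; the
    point [t0] excludes the value -oo of an empty family. *)
Lemma ereal_sup_range_eq (R : realType) (T : Type) (t0 : T) (V : T -> R) (l : R) :
  (forall t, V t <= l) -> (forall b, (forall t, V t <= b) -> l <= b) ->
  ereal_sup (range (fun t => (V t)%:E)) = l%:E.
Proof.
move=> ub least; apply/eqP; rewrite eq_le; apply/andP; split.
  by apply: ge_ereal_sup => _ [t _ <-]; rewrite lee_fin.
have Vle t : ((V t)%:E <= ereal_sup (range (fun t => (V t)%:E)))%E.
  by apply: ereal_sup_ubound; exists t.
case: (ereal_sup _) Vle => [b|_|/(_ t0)]; last by rewrite leeNy_eq.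
- by move=> Vb; rewrite lee_fin; apply: least => t; rewrite -lee_fin.
- exact: leey.
Qed.

Lemma expR_sum_eq1 (R : realType) (A B b c : R) :
  0 < A -> 0 < B -> 0 < b -> 0 < c ->
  exists y, A * expR (b * y) + B * expR (c * y) = 1.
Proof.
move=> A0 B0 b0 c0; pose f y : R := A * expR (b * y) + B * expR (c * y).
have lnK2 (C : R) : 0 < C -> C * expR (- ln (2 * C)) = 2^-1.
  by move=> C0; rewrite expRN lnK ?posrE ?mulr_gt0 // invfM mulrCA divff ?mulr1 ?gt_eqF.
(* At [y1] each summand is at most 1/2; at [y2] the first summand alone equals 1. *)
pose y1 := Num.min (- ln (2 * A) / b) (- ln (2 * B) / c).
pose y2 := - ln A / b.
have y12 : y1 <= y2.
  rewrite ge_min ler_pM2r ?invr_gt0 // lerN2 ler_ln ?posrE ?mulr_gt0 //.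
  by apply/orP; left; lra.
have fc : continuous f.
  have ce d : continuous (fun y : R => expR (d * y)).
    move=> y; apply: continuous_comp; last exact: continuous_expR.
    exact: mulrl_continuous.
  move=> y; apply: cvgD; apply: cvgMl_tmp; exact: ce.
have f1 : f y1 <= 1.
  have : A * expR (b * y1) <= 2^-1.
    rewrite -(lnK2 _ A0) ler_pM2l // ler_expR -ler_pdivlMl //.
    by rewrite [b^-1 * _]mulrC ge_min lexx.
  have : B * expR (c * y1) <= 2^-1.
    rewrite -(lnK2 _ B0) ler_pM2l // ler_expR -ler_pdivlMl //.
    by rewrite [c^-1 * _]mulrC ge_min lexx orbT.
  rewrite /f; lra.
have f2 : 1 <= f y2.
  rewrite /f /y2 [b * _]mulrC divfK ?gt_eqF // expRN lnK ?posrE // divff ?gt_eqF //.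
  by rewrite lerDl mulr_ge0 ?expR_ge0 ?ltW.
have [|y _ fy] := IVT y12 (continuous_subspaceT fc) (v := 1).
  by rewrite ge_min f1 le_max f2 orbT.
by exists y.
Qed.

(** * Minimizers and transforms *)

Section Duality.
Variables (R : realType) (n : nat) (r p0 p2 alpha : R) (phi : 'rV[R]_n -> R).
Hypotheses (r_gt0 : 0 < r) (p0_gt0 : 0 < p0) (p2_lt0 : p2 < 0) (alpha_gt1 : 1 < alpha).
Hypotheses (phi_sconvex : strictly_convex phi) (phi_cont : continuous phi).
Hypotheses (phi_homog : abs_homogeneous alpha phi) (phi_C1 : C1_off0 phi).
Hypothesis grad_bij : set_bij [set x | x != 0] [set x | x != 0] (grad phi).
Implicit Types x y xb : 'rV[R]_n.

Let m : R := Num.sqrt (- (p0 * p2)).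
Let u := ufun r p0 p2.
Let L := objective r p0 p2 phi.

Let alpha_gt0 : 0 < alpha. Proof. exact: lt_trans ltr01 alpha_gt1. Qed.

Let alpha_neq0 : alpha != 0. Proof. by rewrite gt_eqF. Qed.

Let ralpha_gt0 : 0 < r * alpha. Proof. exact: mulr_gt0. Qed.

Let p02_lt0 : p0 * p2 < 0. Proof. by rewrite pmulr_rlt0. Qed.

Let m_gt0 : 0 < m. Proof. by rewrite sqrtr_gt0 oppr_gt0. Qed.

Let sqr_m : m ^+ 2 = - (p0 * p2).
Proof. by rewrite sqr_sqrtr // oppr_ge0 ltW. Qed.

Let phi0 : phi 0 = 0. Proof. exact: homog0 phi_homog _. Qed.

Let phi_gt0 x : x != 0 -> 0 < phi x. Proof. exact: homog_pos. Qed.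

Let phi_ge0 x : 0 <= phi x.
Proof. by have [->|/phi_gt0/ltW//] := eqVneq x 0; rewrite phi0. Qed.

Let phi_diff x : x != 0 -> differentiable phi x. Proof. by case/phi_C1. Qed.

Let grad0 : grad phi 0 = 0. Proof. exact: homog_grad0 phi_homog _. Qed.

(** At 0, where differentiability is not assumed, both sides vanish. *)
Let euler x : dot (grad phi x) x = alpha * phi x.
Proof.
have [->|x0] := eqVneq x 0; first by rewrite dot0r phi0 mulr0.
exact (homog_euler phi_homog (phi_diff x0)).
Qed.

(** * The root equation: critical points, strict minimality, existence *)

Definition root_coef x : R :=
  2 * r * m / Num.sqrt (1 - alpha ^+ 2 * r ^+ 2 * phi x ^+ 2).

Lemma root_arg_gt0 x : phi x < (r * alpha)^-1 ->
  0 < 1 - alpha ^+ 2 * r ^+ 2 * phi x ^+ 2.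
Proof.
rewrite -[_^-1]mulr1 ltr_pdivlMl // => h.
have -> : alpha ^+ 2 * r ^+ 2 * phi x ^+ 2 = (r * alpha * phi x) ^+ 2 by ring.
by rewrite subr_gt0 expr_lt1 // mulr_ge0 // ltW.
Qed.

Lemma root_coef_gt0 x : phi x < (r * alpha)^-1 -> 0 < root_coef x.
Proof.
by move=> h; rewrite divr_gt0 ?mulr_gt0 // sqrtr_gt0 root_arg_gt0.
Qed.

Lemma is_root_dual x : phi x < (r * alpha)^-1 ->
  is_root r p0 p2 alpha phi (root_coef x *: grad phi x) x.
Proof. by []. Qed.

Lemma dot_dual x : dot x (root_coef x *: grad phi x) = root_coef x * (alpha * phi x).
Proof. by rewrite dotZr dotC euler. Qed.

(** With D the square root in [root_coef], Euler's identity gives s = 2 r m alpha phi(x) / D. Since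
    D^2 + (r alpha phi(x))^2 = 1, the number s^2 + 4 m^2 is then the square of [root_coef x / r]. *)
Lemma root_coefE x xb : is_root r p0 p2 alpha phi xb x ->
  root_coef x = r * discr p0 p2 (dot x xb).
Proof.
case=> h <-; rewrite -/m -/(root_coef x) dot_dual.
have c0 := root_coef_gt0 h; have a0 := root_arg_gt0 h.
have d0 : 0 < Num.sqrt (1 - alpha ^+ 2 * r ^+ 2 * phi x ^+ 2) by rewrite sqrtr_gt0.
have dd : Num.sqrt (1 - alpha ^+ 2 * r ^+ 2 * phi x ^+ 2) ^+ 2 =
   1 - alpha ^+ 2 * r ^+ 2 * phi x ^+ 2 by rewrite sqr_sqrtr // ltW.
suff: discr p0 p2 (root_coef x * (alpha * phi x)) = root_coef x / r.
  by move=> ->; rewrite mulrCA divff ?mulr1 // gt_eqF.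
rewrite -[RHS]ger0_norm; last by rewrite divr_ge0 ?(ltW c0) ?(ltW r_gt0).
rewrite -sqrtr_sqr /discr; congr Num.sqrt.
rewrite /root_coef; set D := Num.sqrt _ in d0 dd *.
have -> : 4 * p0 * p2 = - (4 * m ^+ 2) by rewrite sqr_m; ring.
have -> : (2 * r * m / D / r) ^+ 2 =
    4 * m ^+ 2 * (D ^+ 2 + alpha ^+ 2 * r ^+ 2 * phi x ^+ 2) / D ^+ 2.
  by rewrite {1}dd; field; rewrite !gt_eqF.
by field; rewrite !gt_eqF.
Qed.

Lemma root_grad x xb : is_root r p0 p2 alpha phi xb x ->
  grad phi x = (r * discr p0 p2 (dot x xb))^-1 *: xb.
Proof.
move=> H; rewrite -(root_coefE H); case: H => h <-.
by rewrite scalerA -/m -/(root_coef x) mulVf ?scale1r // gt_eqF // root_coef_gt0.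
Qed.

(** The coefficient is positive, and the bijection keeps the gradient nonzero away from 0. *)
Lemma root_eq0 x xb : is_root r p0 p2 alpha phi xb x -> (x == 0) = (xb == 0).
Proof.
case=> h <-; rewrite -/m -/(root_coef x) scaler_eq0 (gt_eqF (root_coef_gt0 h)) /=.
have [->|x0] := eqVneq x 0; first by rewrite grad0 eqxx.
have [gf _ _] := grad_bij; have /= := gf x x0.
by move/negPf => ->.
Qed.

Lemma root_dot_ge0 x xb : is_root r p0 p2 alpha phi xb x -> 0 <= dot x xb.
Proof.
case=> h <-; rewrite -/m -/(root_coef x) dot_dual.
by rewrite mulr_ge0 ?mulr_ge0 // ltW ?root_coef_gt0.
Qed.

Lemma root_strict_min x xb y : is_root r p0 p2 alpha phi xb x -> y != x ->
  L x xb < L y xb.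
Proof.
move=> H yx; rewrite /L /objective -/u.
have [xb0|xb0] := eqVneq xb 0.
  move: (root_eq0 H) yx; rewrite xb0 eqxx => /eqP -> y0.
  by rewrite !dot0r phi0 ltrD2l phi_gt0.
have x0 : x != 0 by rewrite (root_eq0 H).
have s0 := root_dot_ge0 H.
(* Adding the two tangent inequalities at [x] cancels the linear terms, by [root_grad]. *)
have key z : 0 <= dot z xb -> z != x -> u (dot x xb) + phi x < u (dot z xb) + phi z.
  move=> z0 zx; have := ufun_tangent r_gt0 p0_gt0 p2_lt0 s0 z0.
  have := convex_tangent_lt phi_sconvex (phi_diff x0) zx.
  rewrite (root_grad H) dotZl dotDr dotNr !(dotC xb) -/u; lra.
have [y0|y0] := leP 0 (dot y xb); first exact: key.
(* Reflection supplies the strict inequality, since [- y] may be [x] itself. *)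
apply: (@le_lt_trans _ _ (u (dot (- y) xb) + phi (- y))).
  have [->//|yNx] := eqVneq (- y) x.
  by apply/ltW/key => //; rewrite dotNl oppr_ge0 ltW.
rewrite (homog_even phi_homog) ltrD2r; apply: ufun_decr => //.
by rewrite dotNl; lra.
Qed.

Lemma root_unique x y xb : is_root r p0 p2 alpha phi xb x ->
  is_root r p0 p2 alpha phi xb y -> x = y.
Proof.
move=> hx hy; apply/eqP/negPn/negP => xy.
have := root_strict_min hy xy; rewrite eq_sym in xy.
by have := root_strict_min hx xy; lra.
Qed.

(** For nonzero [xb] the root is sought as t z with grad phi(z) = xb. By homogeneity the squared
    equation reads A t^(2 (alpha - 1)) + B t^(2 alpha) = 1, solved with t = exp v. *)
Lemma root_exists xb : exists x, is_root r p0 p2 alpha phi xb x.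
Proof.
have [->|xb0] := eqVneq xb 0.
  exists 0; rewrite /is_root grad0 scaler0; split=> //.
  by rewrite phi0 invr_gt0.
have [_ _ /(_ xb xb0)[/= z z0 gz]] := grad_bij.
have a0 : 0 < alpha - 1 by rewrite subr_gt0.
have pz := phi_gt0 z0.
have A0 : 0 < (2 * r * m) ^+ 2 by rewrite exprn_gt0 // !mulr_gt0.
have B0 : 0 < (r * alpha * phi z) ^+ 2 by rewrite exprn_gt0 // !mulr_gt0.
have [||v E] := expR_sum_eq1 A0 B0 (b := (alpha - 1) * 2) (c := alpha * 2).
- exact: mulr_gt0.
- exact: mulr_gt0.
pose t := expR v; have t0 : 0 < t := expR_gt0 v.
have tE a : t `^ a = expR (a * v) by rewrite /powR gt_eqF // /t expRK.
have ex2 a : expR (a * 2 * v) = (t `^ a) ^+ 2.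
  by rewrite tE -expRM_natr; congr expR; ring.
rewrite !ex2 -!exprMn in E.
have tz0 : t *: z != 0 by rewrite scaler_eq0 negb_or z0 gt_eqF.
have phit : phi (t *: z) = t `^ alpha * phi z by rewrite phi_homog gtr0_norm.
have gradt : grad phi (t *: z) = t `^ (alpha - 1) *: xb.
  by rewrite (homog_grad phi_homog t0) ?gz //; exact: phi_diff.
have ta : 0 < t `^ (alpha - 1) by rewrite powR_gt0.
(* The other summand is positive, so this one is below 1; this is the level bound required of a
   root. *)
have lt1 : (r * alpha * phi (t *: z)) ^+ 2 < 1.
  have : 0 < (2 * r * m * t `^ (alpha - 1)) ^+ 2 by rewrite exprn_gt0 // !mulr_gt0.
  have -> : r * alpha * phi (t *: z) = r * alpha * phi z * t `^ alpha by rewrite phit; ring.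
  by lra.
exists (t *: z); split.
  rewrite -[_^-1]mulr1 ltr_pdivlMl //.
  by rewrite expr_lt1 // ?mulr_ge0 // in lt1; apply: ltW.
rewrite gradt scalerA.
have -> : 1 - alpha ^+ 2 * r ^+ 2 * phi (t *: z) ^+ 2 = (2 * r * m * t `^ (alpha - 1)) ^+ 2.
  by rewrite phit -[X in X - _]E; ring.
rewrite sqrtr_sqr gtr0_norm ?mulr_gt0 //.
rewrite -[RHS]scale1r; congr (_ *: _); rewrite -/m; field.
by rewrite !gt_eqF.
Qed.

(* The tangents of phi at the points whose gradient is +delta_i or -delta_i bound
   the i-th coordinate by phi plus a constant. *)
Lemma homog_bounded (c : R) : exists M : R, forall y, phi y <= c -> `|y| <= M.
Proof.
have /choice[K HK] : forall i : 'I_n, exists K : R, forall y, `|y 0 i| <= phi y + K.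
  move=> i.
  have e0 (s : R) : s != 0 -> s *: delta_mx 0 i != 0 :> 'rV[R]_n.
    move=> s0; rewrite scaler_eq0 negb_or s0; apply/eqP => /rowP/(_ i).
    by rewrite !mxE !eqxx; apply/eqP; rewrite oner_neq0.
  have up (s : R) : s != 0 -> exists K : R, forall y, s * y 0 i <= phi y + K.
    move=> s0; have [_ _ /(_ _ (e0 s s0))[/= z z0 gz]] := grad_bij.
    exists (dot (grad phi z) z - phi z) => y.
    have := convex_tangent_le phi_sconvex y (phi_diff z0).
    by rewrite gz dotDr dotNr !dotZl !(dotC (delta_mx _ _)) !dot_delta; lra.
  have [K1 H1] := up 1 (oner_neq0 _).
  have [|K2 H2] := up (-1); first by rewrite oppr_eq0 oner_neq0.
  exists (Num.max K1 K2) => y; rewrite ler_norml.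
  have := H1 y; have := H2 y.
  have : K1 <= Num.max K1 K2 by rewrite le_max lexx.
  have : K2 <= Num.max K1 K2 by rewrite le_max lexx orbT.
  by move=> ? ? ? ?; apply/andP; split; lra.
(* Absolute values make the bound nonnegative, as a maximum norm requires even for [n = 0], and let
   the sum dominate each [K i]. *)
exists (\sum_i `|K i| + `|c|) => y yc.
rewrite [leLHS]/Num.norm /= mx_normrE; apply/bigmax_leP; split => /=.
  by rewrite addr_ge0 // sumr_ge0.
move=> [a i] _ /=; rewrite ord1; apply: le_trans (HK i y) _.
rewrite addrC lerD // ?(le_trans yc) ?ler_norm //.
rewrite (le_trans (ler_norm _)) // (bigD1 i) //= lerDl sumr_ge0 //.
Qed.

(** * The minimizer as a function of the dual point, and the first transform *)

Variable xopt : 'rV[R]_n -> 'rV[R]_n.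
Hypothesis xoptP : forall xb, is_root r p0 p2 alpha phi xb (xopt xb).

Lemma xopt_min xb y : L (xopt xb) xb <= L y xb.
Proof.
have [->//|] := eqVneq y (xopt xb).
by move=> /(root_strict_min (xoptP xb))/ltW.
Qed.

Lemma xopt_unique xb x : global_min (L ^~ xb) x -> xopt xb = x.
Proof.
move=> xmin; apply/esym/eqP/negPn/negP => /(root_strict_min (xoptP xb)).
by rewrite ltNge; have := xmin (xopt xb) => /= ->.
Qed.

Lemma xopt_dual x : phi x < (r * alpha)^-1 ->
  xopt (root_coef x *: grad phi x) = x.
Proof. by move=> /is_root_dual; apply: root_unique. Qed.

Lemma cbar_transformE xb :
  cbar_transform (@cost R n r p0 p2) (EFin \o phi) xb = (- L (xopt xb) xb)%:E.
Proof.
have -> : cbar_transform (@cost R n r p0 p2) (EFin \o phi) xb =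
    ereal_sup (range (fun x => (- L x xb)%:E)).
  rewrite /cbar_transform (_ : (fun x => _) = (fun x => (- L x xb)%:E)) //.
  apply/funext => x.
  by rewrite /L /objective opprD.
apply: (ereal_sup_range_eq 0) => [x|b]; last exact.
by rewrite lerN2 xopt_min.
Qed.

Lemma continuous_objective xb : continuous (L ^~ xb).
Proof.
move=> x; apply: (@continuousD _ _ _ (fun x => u (dot x xb)) phi); last first.
  exact: phi_cont.
apply: (@continuous_comp _ _ _ (fun x => dot x xb) u); last exact: continuous_ufun.
by apply: (@cvg_dot R n _ (nbhs x) _ id (fun=> xb)); [exact: cvg_id|exact: cvg_cst].
Qed.

(** On a sublevel set of [phi] the points are bounded, so the Lipschitz constant of u yields one in
    the dual variable that is uniform in [y]. *)
Lemma objective_lipschitz (c : R) : exists2 K, 0 < K & forall y xb yb, phi y <= c ->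
  `|L y xb - L y yb| <= K * `|xb - yb|.
Proof.
have [M HM] := homog_bounded c.
have [K K0 HK] := ufun_lipschitz r_gt0 p0_gt0 p2_lt0.
exists (K * (n%:R * `|M| + 1)); first by rewrite mulr_gt0 // ltr_wpDl ?mulr_ge0.
move=> y xb yb /HM yM.
rewrite /L /objective -/u opprD addrACA subrr addr0 (le_trans (HK _ _)) //.
rewrite -mulrA ler_pM2l // -dotNr -dotDr (le_trans (norm_dot_le _ _)) //.
rewrite mulrDl mul1r -[leLHS]addr0 lerD // ler_wpM2r // ler_wpM2l //.
by rewrite (le_trans yM) ?ler_norm.
Qed.

Lemma xopt_continuous : continuous xopt.
Proof.
move=> xb; apply/(@cvgrPdist_lt R 'rV[R]_n _ (nbhs xb) _ xopt) => e e0.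
set x := xopt xb; pose c := (r * alpha)^-1.
have xc yb : phi (xopt yb) <= c by have [/ltW] := xoptP yb.
(* The compact set of competitors far from [x]: all minimizers lie in the sublevel set, so it
   suffices that those near [xb] avoid [K]. *)
pose K := [set y | phi y <= c] `&` [set y | e <= `|x - y|].
have cK : compact K.
  apply: bounded_closed_compact.
    have [M HM] := homog_bounded c.
    exists M; split; first exact: num_real.
    by move=> M' /ltW MM' y [/HM yM _]; apply: le_trans yM MM'.
  apply: closedI.
    apply: (preimage_closed (f := phi)) (@closed_le _ _) => y _; exact: phi_cont.
  apply: (preimage_closed (f := fun y => `|x - y|)) (@closed_ge _ _) => y _.
  apply: (@cvg_norm _ _ _ (nbhs y)).
  by apply: (@cvgB _ _ _ (nbhs y) _ (fun=> x) id); [exact: cvg_cst|exact: cvg_id].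
have [K0|/set0P K0] := eqVneq K set0.
  near=> yb; rewrite ltNge; apply/negP => h.
  have : K (xopt yb) by split; [exact: xc|].
  by rewrite K0.
have [z zK zmin] := compact_EVT_min K0 cK (continuous_subspaceT (@continuous_objective xb)).
have zx : L x xb < L z xb.
  apply: root_strict_min (xoptP xb) _.
  move: zK; rewrite inE => -[_ /=]; apply: contraTneq => ->.
  by rewrite subrr normr0 -ltNge.
have [C C0 HC] := objective_lipschitz c.
(* Moving the dual point by less than [d] changes the objective by less than half the gap, both at
   [x] and at [xopt yb]; a minimizer in [K] would then contradict its minimality. *)
pose d := (L z xb - L x xb) / (2 * C).
have d0 : 0 < d by rewrite divr_gt0 ?subr_gt0 // mulr_gt0.
near=> yb; rewrite ltNge; apply/negP => h.
have zy : L z xb <= L (xopt yb) xb.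
  by apply: zmin; rewrite inE; split; [exact: xc|].
have bd : `|xb - yb| < d by near: yb; apply: cvgr_dist_lt => //; exact: cvg_id.
have bd' : C * `|xb - yb| < (L z xb - L x xb) / 2.
  move: bd; rewrite /d invfM mulrA ltr_pdivlMr // [_ * C]mulrC.
  by [].
have := HC _ xb yb (xc yb); have := HC _ xb yb (xc xb).
have := xopt_min yb x.
rewrite !ler_norml -/x => ? /andP[? ?] /andP[? ?]; lra.
Unshelve. all: by end_near. Qed.

(** The envelope formula: the gradient of -u(x . xb) in [xb] with the minimizer x held fixed. *)
Definition opt_grad xb : 'rV[R]_n := (r * discr p0 p2 (dot (xopt xb) xb))^-1 *: xopt xb.

(* By definition of the minimizers, the increment of psi from xb to yb is at least
   the increment of -u along xopt xb and at most the one along xopt yb. *)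
Lemma differentiable_psi xb :
  differentiable (fun yb => - L (xopt yb) yb) xb /\
  grad (fun yb => - L (xopt yb) yb) xb = opt_grad xb.
Proof.
(* Mean value points are chosen as a function of the pair, so that increments of u become scalar
   products with [G] and limits can be taken. *)
have /choice[c Hc] : forall p : 'rV[R]_n * 'rV[R]_n, exists c,
    Num.min (dot p.1 xb) (dot p.1 p.2) <= c <= Num.max (dot p.1 xb) (dot p.1 p.2) /\
    u (dot p.1 xb) - u (dot p.1 p.2) = dot ((r * discr p0 p2 c)^-1 *: p.1) (p.2 - xb).
  move=> [y yb] /=; have [c cI E] := ufun_mvt r_gt0 p0_gt0 p2_lt0 (dot y xb) (dot y yb).
  by exists c; split=> //; rewrite /u E dotZl dotDr dotNr.
pose G (p : 'rV[R]_n * 'rV[R]_n) := (r * discr p0 p2 (c p))^-1 *: p.1.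
have cvgG (f : 'rV[R]_n -> 'rV[R]_n) : f yb @[yb --> xb] --> xopt xb ->
    G (f yb, yb) @[yb --> xb] --> opt_grad xb.
  move=> fx.
  have rd : r * discr p0 p2 (dot (xopt xb) xb) != 0.
    by rewrite gt_eqF // mulr_gt0 // discr_gt0.
  apply: (@cvgZ _ _ _ (nbhs xb) _ (fun yb => (r * discr p0 p2 (c (f yb, yb)))^-1) f) => //.
  apply: (@cvgV _ _ (nbhs xb) _ (fun yb => r * discr p0 p2 (c (f yb, yb)))) => //.
  apply: (@cvgMl_tmp _ _ (nbhs xb)).
  apply: (cvg_comp (fun yb => c (f yb, yb)) (discr p0 p2)); last exact: continuous_discr.
  apply: (@cvg_between _ _ (nbhs xb) _ (fun yb => dot (f yb) xb) (fun yb => dot (f yb) yb)).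
  - by apply: (cvg_dot _ fx (g := fun=> xb)); exact: cvg_cst.
  - by apply: (cvg_dot _ fx (g := id)); exact: cvg_id.
  - by move=> yb; have [] := Hc (f yb, yb).
have n0 : 0 < n.+1%:R :> R by rewrite ltr0n.
apply: differentiable_grad_eps => e e0.
(* With the maximum norm a scalar product costs a factor n; n + 1 also covers dimension 0. *)
have e1 : 0 < e / n.+1%:R by rewrite divr_gt0.
have near1 : \forall yb \near xb, `|opt_grad xb - G (xopt xb, yb)| < e / n.+1%:R.
  have cf : (fun=> xopt xb) yb @[yb --> xb] --> xopt xb.
    exact: (@cvg_cst _ (xopt xb) _ (nbhs xb) _).
  exact: (@cvgr_dist_lt _ _ _ (nbhs xb) _ _ _ (cvgG _ cf) _ e1).
have near2 : \forall yb \near xb, `|opt_grad xb - G (xopt yb, yb)| < e / n.+1%:R.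
  exact: (@cvgr_dist_lt _ _ _ (nbhs xb) _ _ _ (cvgG _ (@xopt_continuous xb)) _ e1).
near=> yb.
have bound (w : 'rV[R]_n) : `|opt_grad xb - w| < e / n.+1%:R ->
    `|dot w (yb - xb) - dot (opt_grad xb) (yb - xb)| <= e * `|yb - xb|.
  rewrite ltr_pdivlMr // => /ltW we.
  rewrite distrC -dotNl -dotDl (le_trans (norm_dot_le _ _)) //.
  apply: ler_wpM2r => //; apply: le_trans we.
  by rewrite mulrC ler_wpM2l // ler_nat.
have b1 : `|dot (G (xopt xb, yb)) (yb - xb) - dot (opt_grad xb) (yb - xb)| <= e * `|yb - xb|.
  by apply: bound; near: yb.
have b2 : `|dot (G (xopt yb, yb)) (yb - xb) - dot (opt_grad xb) (yb - xb)| <= e * `|yb - xb|.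
  by apply: bound; near: yb.
have [_ E1] := Hc (xopt xb, yb); have [_ E2] := Hc (xopt yb, yb).
rewrite -/(G _) /= in E1; rewrite -/(G _) /= in E2.
have m1 := xopt_min yb (xopt xb); have m2 := xopt_min xb (xopt yb).
move: b1 b2; rewrite -E1 -E2 !ler_norml.
move: m1 m2; rewrite /L /objective -/u => ? ? /andP[? ?] /andP[? ?].
by apply/andP; split; lra.
Unshelve. all: by end_near. Qed.

(** The left side is s / (r q(s)), and s < q(s). *)
Lemma dot_opt_grad xb : dot xb (opt_grad xb) < r^-1.
Proof.
rewrite /opt_grad dotZr dotC invfM -mulrA gtr_pMr ?invr_gt0 //.
rewrite mulrC ltr_pdivrMr ?discr_gt0 // mul1r.
by apply: le_lt_trans (ler_norm _) _; exact: norm_lt_discr.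
Qed.

(** * The double transform, below and above the critical level *)

Lemma c_transformE x : c_transform (@cost R n r p0 p2)
    (cbar_transform (@cost R n r p0 p2) (EFin \o phi)) x = (phi_log r alpha phi x)%:E.
Proof.
have -> : cbar_transform (@cost R n r p0 p2) (EFin \o phi) =
    fun xb => (- L (xopt xb) xb)%:E by apply/funext => xb; exact: cbar_transformE.
pose V xb := L (xopt xb) xb - u (dot x xb).
have -> : c_transform (@cost R n r p0 p2) (fun xb => (- L (xopt xb) xb)%:E) x =
    ereal_sup (range (fun xb => (V xb)%:E)).
  rewrite /c_transform (_ : (fun xb => _) = (fun xb => (V xb)%:E)) //.
  apply/funext => xb.
  by rewrite /V -[in RHS](opprK (L _ _)) addrC.
rewrite /phi_log; case: ifPn => [hx|].
  apply: (ereal_sup_range_eq 0) => [xb|b Vb].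
    by have := xopt_min xb x; rewrite {2}/L /objective /V -/u; lra.
  (* The supremum is attained at the dual point of [x], whose minimizer is [x] itself. *)
  have := Vb (root_coef x *: grad phi x).
  by rewrite /V xopt_dual // /L /objective -/u; lra.
rewrite -leNgt => hx.
have phix : 0 < phi x by apply: lt_le_trans hx; rewrite invr_gt0.
(* tau x lies on the level set phi = 1/(r alpha). *)
pose tau := (r * alpha * phi x) `^ (- alpha^-1).
have rax : 0 < r * alpha * phi x by rewrite mulr_gt0.
have tau0 : 0 < tau by rewrite powR_gt0.
have taua : tau `^ alpha = (r * alpha * phi x)^-1.
  by rewrite -powRrM mulNr mulVf // powR_inv1 // ltW.
have taux : tau `^ alpha * phi x = (r * alpha)^-1.
  by rewrite taua invfM -mulrA mulVf ?mulr1 // gt_eqF.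
have lntau : - r^-1 * ln tau = (r * alpha)^-1 * ln (r * alpha * phi x).
  by rewrite ln_powR invfM mulrA mulrNN.
have -> : (r * alpha)^-1 * (1 + ln (r * alpha * phi x)) =
    - r^-1 * ln tau + (r * alpha)^-1 by rewrite lntau; ring.
apply: (ereal_sup_range_eq 0) => [xb|b Vb].
  have tau1 : 0 < tau <= 1.
    rewrite tau0 /= /tau -(powRr0 (r * alpha * phi x)) ler_powR //.
      by rewrite -ler_pdivrMl // mulr1.
    by rewrite oppr_le0 invr_ge0 ltW.
  (* Upper bound: the minimum is compared with the value at [tau *: x], and u(tau s) - u(s) is at
     most the logarithmic term. *)
  have := ufun_scale_le r_gt0 p0_gt0 p2_lt0 (dot x xb) tau1.
  have := xopt_min xb (tau *: x).
  rewrite {2}/L /objective /V dotZl phi_homog (gtr0_norm tau0) taux -/u; lra.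
(* [D t] is the square root in the root equation at [t *: x], and [W t] will be a lower bound for
   [V] at the dual point of [t *: x]. As [D] vanishes at [tau], [W tau] is the claimed supremum. *)
pose D t : R := Num.sqrt (1 - alpha ^+ 2 * r ^+ 2 * (t `^ alpha * phi x) ^+ 2).
pose W t : R := - r^-1 * ln (t + t * D t / (2 * r * alpha * (t `^ alpha * phi x)))
   + t `^ alpha * phi x.
have Wtau : W tau = - r^-1 * ln tau + (r * alpha)^-1.
  rewrite /W /D taux.
  have -> : alpha ^+ 2 * r ^+ 2 * (r * alpha)^-1 ^+ 2 = 1.
    by field; rewrite !gt_eqF.
  by rewrite subrr sqrtr0 mulr0 mul0r addr0.
have cp : (t `^ alpha * phi x) @[t --> tau] --> tau `^ alpha * phi x.
  apply: cvgMr_tmp.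
  by have [/derivable1_diffP/differentiable_continuous] := is_derive1_powR alpha tau0.
have cD : D t @[t --> tau] --> D tau.
  apply: (cvg_comp _ (@Num.sqrt R)); last exact: sqrt_continuous.
  apply: cvgB; first exact: cvg_cst.
  apply: cvgMl_tmp.
  by apply: (cvg_comp _ (fun s : R => s ^+ 2) cp); exact: exprn_continuous.
have cW : W t @[t --> tau] --> W tau.
  apply: cvgD => //; apply: cvgMl_tmp.
  apply: (cvg_comp _ (@ln R)); last first.
    apply: continuous_ln.
    by rewrite ltr_pwDl // divr_ge0 ?mulr_ge0 ?sqrtr_ge0 ?powR_ge0 // ltW.
  apply: cvgD; first exact: cvg_id.
  apply: cvgM; first by apply: cvgM => //; exact: cvg_id.
  apply: cvgV; last exact: cvgMl_tmp.
  by rewrite taux gt_eqF // !mulr_gt0 // invr_gt0.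
(* The limit is taken from the left because only for [t < tau] is [t *: x] below the critical level,
   hence a minimizer. *)
rewrite -Wtau; apply: (cvgr_to_le (cvg_at_left_filter cW)); near=> t.
have t0 : 0 < t by near: t; exact: nbhs_left_gt.
have ttau : t < tau by near: t; exact: nbhs_left_lt.
have phit : phi (t *: x) = t `^ alpha * phi x by rewrite phi_homog gtr0_norm.
have ht : phi (t *: x) < (r * alpha)^-1.
  by rewrite phit -taux ltr_pM2r // gt0_ltr_powR ?nnegrE // ltW.
pose xb := root_coef (t *: x) *: grad phi (t *: x).
apply: le_trans (Vb xb).
have c0 := root_coef_gt0 ht.
have pt : 0 < t `^ alpha * phi x by rewrite mulr_gt0 // powR_gt0.
have sE : dot x xb = t^-1 * (root_coef (t *: x) * (alpha * phi (t *: x))).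
  by rewrite -dot_dual dotZl mulKf // gt_eqF.
have s0 : 0 < dot x xb.
  by rewrite sE phit (mulr_gt0 _ (mulr_gt0 c0 (mulr_gt0 alpha_gt0 pt))) // invr_gt0.
have := ufun_scale_ge r_gt0 p0_gt0 p2_lt0 s0 t0.
rewrite /V xopt_dual // /L /objective -/u dotZl phit -/m.
(* Identifies the correction term of [ufun_scale_ge] with the one in [W]. *)
suff -> : m / dot x xb = t * D t / (2 * r * alpha * (t `^ alpha * phi x)).
  by rewrite /W; lra.
have D0 : 0 < D t by rewrite sqrtr_gt0 -phit root_arg_gt0.
rewrite sE phit /root_coef phit -/(D t); field.
by rewrite !gt_eqF ?powR_gt0.
Unshelve. all: by end_near. Qed.

End Duality.

Theorem proposition11 (R : realType) (n : nat) (r p0 p2 alpha : R)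
  (phi : 'rV[R]_n -> R)
  (r_gt0 : 0 < r) (p0_gt0 : 0 < p0) (p2_lt0 : p2 < 0) (alpha_gt1 : 1 < alpha)
  (phi_sconvex : strictly_convex phi)
  (phi_cont : continuous phi)
  (phi_homog : abs_homogeneous alpha phi)
  (phi_C1 : C1_off0 phi)
  (grad_bij : set_bij [set x | x != 0] [set x | x != 0] (grad phi)) :
  exists xopt : 'rV[R]_n -> 'rV[R]_n,
  let c := @cost R n r p0 p2 in
  let L := objective r p0 p2 phi in
  let psi := fun xb => fine (cbar_transform c (EFin \o phi) xb) in
  [/\ forall xb, unique (global_min (L ^~ xb)) (xopt xb),
      forall xb, xb != 0 -> unique (is_root r p0 p2 alpha phi xb) (xopt xb),
      xopt 0 = 0,
      forall xb, cbar_transform c (EFin \o phi) xb = (- L (xopt xb) xb)%:E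
    & [/\ forall xb, differentiable psi xb /\ dot xb (grad psi xb) < r^-1,
          forall x, c_transform c (cbar_transform c (EFin \o phi)) x =
                    (phi_log r alpha phi x)%:E
        & c_convex c (EFin \o phi_log r alpha phi)]].
Proof.
have /choice[xopt xoptP] := root_exists r_gt0 p0_gt0 p2_lt0 alpha_gt1
  phi_sconvex phi_homog phi_C1 grad_bij.
exists xopt => c L psi.
have cbarE xb : cbar_transform c (EFin \o phi) xb = (- L (xopt xb) xb)%:E.
  exact: (cbar_transformE r_gt0 p0_gt0 p2_lt0 alpha_gt1 phi_sconvex phi_homog phi_C1
    grad_bij xoptP).
have ctE x : c_transform c (cbar_transform c (EFin \o phi)) x =
    (phi_log r alpha phi x)%:E.
  exact: (c_transformE r_gt0 p0_gt0 p2_lt0 alpha_gt1 phi_sconvex phi_homog phi_C1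
    grad_bij xoptP).
split=> //.
- move=> xb; split=> [y|x xmin].
    exact: (xopt_min r_gt0 p0_gt0 p2_lt0 alpha_gt1 phi_sconvex phi_homog phi_C1
      grad_bij xoptP).
  exact: (xopt_unique r_gt0 p0_gt0 p2_lt0 alpha_gt1 phi_sconvex phi_homog phi_C1
    grad_bij xoptP xmin).
- move=> xb _; split=> // x.
  exact: (root_unique r_gt0 p0_gt0 p2_lt0 alpha_gt1 phi_sconvex phi_homog phi_C1
    grad_bij (xoptP xb)).
- apply/eqP; have := xoptP 0.
  move=> /(root_eq0 r_gt0 p0_gt0 p2_lt0 alpha_gt1 phi_sconvex phi_homog grad_bij) ->.
  exact: eqxx.
split=> //; last first.
  (* The witness for c-convexity is the first transform of [phi]. *)
  by exists (cbar_transform c (EFin \o phi)); apply/funext => x; rewrite ctE.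
have -> : psi = fun yb => - L (xopt yb) yb.
  by apply/funext => yb; rewrite /psi cbarE.
move=> xb; have [dpsi ->] := differentiable_psi r_gt0 p0_gt0 p2_lt0 alpha_gt1
  phi_sconvex phi_cont phi_homog phi_C1 grad_bij xoptP xb.
by split=> //; apply: dot_opt_grad.
Qed.
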